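(* Let $\mathbb{V}$ be a finite-dimensional vector space over a finite field $\mathbb{F}$ with $q$ elements, with basis $\{\alpha_1,\ldots,\alpha_n\}$, and let $\Gamma$ be its non-zero component graph with respect to this basis. Let $1\leq k\leq n$, let $i_1,\ldots,i_k\in\{1,\ldots,n\}$ be distinct indices, and let $c_1,\ldots,c_k\in\mathbb{F}$ with $c_1c_2\cdots c_k\neq 0$. Then the degree of the vertex $c_1\alpha_{i_1}+c_2\alpha_{i_2}+\cdots+c_k\alpha_{i_k}$ in $\Gamma$ is $(q^k-1)q^{n-k}-1$.
   Context: Let $\theta$ be the null vector of $\mathbb{V}$. Every $\mathbf{a}\in\mathbb{V}$ is written uniquely as $\mathbf{a}=a_1\alpha_1+\cdots+a_n\alpha_n$ with $a_i\in\mathbb{F}$. The non-zero component graph $\Gamma$ with respect to the basis $\{\alpha_1,\ldots,\alpha_n\}$ is the simple graph with vertex set $\mathbb{V}\setminus\{\theta\}$ in which two distinct vertices $\mathbf{a},\mathbf{b}$ are adjacent if and only if there is an index $i$ with $a_i\neq 0$ and $b_i\neq 0$ (a vertex is not counted as its own neighbour). The degree of a vertex is the number of vertices adjacent to it. *)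

(* Defs.v *)
From HB Require Import structures.
From mathcomp Require Import all_boot all_order all_algebra all_field.

Set Implicit Arguments.
Unset Strict Implicit.
Unset Printing Implicit Defensive.

Import GRing.Theory.
Local Open Scope ring_scope.

Definition degree (T : finType) (e : rel T) (x : T) : nat :=
  #|[set y : T | e x y]|.

(* [finvect_type V] is [V] with the finType structure it inherits from the
   finite scalar field. *)
Definition nzvec (F : finFieldType) (V : vectType F) : finType :=
  {v : finvect_type V | v != 0}.

Definition nzvec_val (F : finFieldType) (V : vectType F) (a : nzvec V) : V :=
  val a.

(* When [alpha] is a basis of [V], [coord alpha i a] is the i-th coefficient
   in the unique expansion of [a] over [alpha] (see [coord_basis] and
   [coord_sum_free] in mathcomp's vector.v). *)
Definition nz_component_adj (F : finFieldType) (V : vectType F) (n : nat)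
    (alpha : n.-tuple V) : rel (nzvec V) :=
  fun a b => (a != b) &&
    [exists i : 'I_n, (coord alpha i (nzvec_val a) != 0)
                   && (coord alpha i (nzvec_val b) != 0)].

Lemma nz_component_adj_sym (F : finFieldType) (V : vectType F) (n : nat)
    (alpha : n.-tuple V) : symmetric (nz_component_adj alpha).
Proof.
move=> a b; rewrite /nz_component_adj eq_sym; congr (_ && _).
by apply: eq_existsb => i; rewrite andbC.
Qed.

Lemma nz_component_adj_irr (F : finFieldType) (V : vectType F) (n : nat)
    (alpha : n.-tuple V) : irreflexive (nz_component_adj alpha).
Proof. by move=> a; rewrite /nz_component_adj eqxx. Qed.

(* Main.v *)
Require Import Defs.
From HB Require Import structures.
From mathcomp Require Import all_boot all_order all_algebra all_field.

Set Implicit Arguments.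
Unset Strict Implicit.
Unset Printing Implicit Defensive.

Import GRing.Theory.
Local Open Scope ring_scope.

(* A nonzero vector meets the support S of v exactly when its coordinate
   function does not vanish on S; of the q^n coordinate functions, q^(n-k)
   vanish on S.  This count includes v itself, whence the final -1. *)

Lemma coord_tnth_free (K : fieldType) (V : vectType K) (n : nat)
    (X : n.-tuple V) (j l : 'I_n) :
  free X -> coord X j (tnth X l) = (j == l)%:R.
Proof. by move=> fX; rewrite (tnth_nth 0) coord_free // eq_sym. Qed.

Lemma coord_sum_tnth_inj (K : fieldType) (V : vectType K) (n k : nat)
    (X : n.-tuple V) (i : 'I_k -> 'I_n) (c : 'I_k -> K) (l : 'I_k) :
  free X -> injective i ->
  coord X (i l) (\sum_(j < k) c j *: tnth X (i j)) = c l.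
Proof.
move=> fX inj_i; rewrite linear_sum (bigD1 l) //= big1 => [|j jl].
  by rewrite linearZ /= coord_tnth_free // eqxx mulr1 addr0.
by rewrite linearZ /= coord_tnth_free // (inj_eq inj_i) eq_sym (negPf jl) mulr0.
Qed.

Lemma coord_sum_tnth_notin (K : fieldType) (V : vectType K) (n k : nat)
    (X : n.-tuple V) (i : 'I_k -> 'I_n) (c : 'I_k -> K) (m : 'I_n) :
  free X -> m \notin codom i ->
  coord X m (\sum_(j < k) c j *: tnth X (i j)) = 0.
Proof.
move=> fX mNi; rewrite linear_sum big1 // => j _.
rewrite linearZ /= coord_tnth_free //; case: eqP => [mij|_]; last by rewrite mulr0.
by rewrite mij codom_f in mNi.
Qed.

(** The complement consists of the functions vanishing on [S]; each is determined by its free values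
    off [S]. Subtracting their number from [#|R| ^ #|I|] and factoring gives the product. *)
Lemma card_ffun_nz_on (I : finType) (R : finNzRingType) (S : {set I}) :
  #|[set f : {ffun I -> R} | [exists j in S, f j != 0]]|
    = ((#|R| ^ #|S| - 1) * #|R| ^ (#|I| - #|S|))%N.
Proof.
set A := [set f | _].
have AC : #|~: A| = (#|R| ^ (#|I| - #|S|))%N.
  have -> : (#|I| - #|S|)%N = #|~: S| by rewrite [RHS]cardsCs setCK.
  (* Vanishing on [S] is recast as having support, with default value [0], inside [~: S]; [predT]
     leaves the values there unrestricted. *)
  rewrite -(card_pffun_on 0 (~: S) predT).
  apply: eq_card => f; rewrite !inE negb_exists.
  apply/forallP/pffun_onP => [f0 | [supp_f _] j].
    split=> //; apply/subsetP => j; rewrite !inE => fj.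
    by have := f0 j; rewrite fj andbT.
  rewrite negb_and negbK -implybE; apply/implyP => jS.
  by apply: contraTT jS => fj; have := subsetP supp_f j fj; rewrite inE.
have := cardsC A; rewrite AC card_ffun => cardA.
by rewrite mulnBl mul1n -expnD subnKC ?max_card // -cardA addnK.
Qed.

(** The coordinate map carries this set bijectively onto the functions counted by [card_ffun_nz_on].
    Excluding the null vector loses nothing, since its coordinate function vanishes on [S]. *)
Lemma card_nzvec_meeting (F : finFieldType) (V : vectType F) (n : nat)
    (alpha : n.-tuple V) (S : {set 'I_n}) :
  basis_of fullv alpha ->
  #|[set w : nzvec V | [exists j in S, coord alpha j (nzvec_val w) != 0]]|
    = ((#|F| ^ #|S| - 1) * #|F| ^ (n - #|S|))%N.
Proof.
move=> basis_alpha; have free_alpha := basis_free basis_alpha.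
pose g (w : nzvec V) := [ffun j => coord alpha j (nzvec_val w)].
have g_inj : injective g.
  move=> u w /ffunP guw; apply: val_inj; rewrite -!/(nzvec_val _).
  rewrite (coord_basis basis_alpha (memvf (nzvec_val u))).
  rewrite (coord_basis basis_alpha (memvf (nzvec_val w))).
  by apply: eq_bigr => j _; have := guw j; rewrite !ffunE => ->.
rewrite -[X in (X - #|S|)%N]card_ord -card_ffun_nz_on -(card_imset _ g_inj).
congr #|pred_of_set _|; apply/setP => f; rewrite inE.
apply/imsetP/existsP => [[w + ->]|[j /andP[jS fj]]].
  by rewrite inE => /existsP[j jw]; exists j; rewrite ffunE.
(* The preimage of [f] is the vector with coordinates [f]; it is a vertex because [f j] is
   nonzero. *)
pose w : V := \sum_(l < n) f l *: alpha`_l.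
have wE l : coord alpha l w = f l by rewrite coord_sum_free.
have w0 : (w : finvect_type V) != 0.
  by apply: contraNneq fj => w0; rewrite -wE w0 linear0.
exists (exist _ (w : finvect_type V) w0 : nzvec V).
  by rewrite inE; apply/existsP; exists j; rewrite jS wE.
by apply/ffunP => l; rewrite ffunE wE.
Qed.

Theorem theorem7p1 (F : finFieldType) (V : vectType F) (q : nat)
    (hq : #|F| = q) (n : nat) (alpha : n.-tuple V)
    (halpha : basis_of fullv alpha)
    (k : nat) (hk1 : (1 <= k)%N) (hkn : (k <= n)%N)
    (i : 'I_k -> 'I_n) (hi : injective i)
    (c : 'I_k -> F) (hc : \prod_(j < k) c j != 0) :
  exists v : nzvec V,
    nzvec_val v = \sum_(j < k) c j *: tnth alpha (i j)
    /\ degree (nz_component_adj alpha) v = ((q ^ k - 1) * q ^ (n - k) - 1)%N.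
Proof.
have free_alpha := basis_free halpha.
set x : V := \sum_(j < k) _.
pose S := [set i j | j : 'I_k].
have cardS : #|S| = k by rewrite card_imset // card_ord.
(* The support of [x] is all of [S]: a nonzero product has no zero factor [c l], and injectivity of
   [i] keeps coefficients from merging. *)
have xS m : (coord alpha m x != 0) = (m \in S).
  apply/idP/imsetP => [xm|[l _ ->]].
    have /codomP[l ml] : m \in codom i.
      by apply: contraR xm => mNi; rewrite coord_sum_tnth_notin.
    by exists l.
  by rewrite coord_sum_tnth_inj //; move/prodf_neq0: hc; apply.
(* Since [k] is positive, index [0] exists; it witnesses both that [x] is nonzero and that [v] meets
   its own support. *)
pose j0 := Ordinal hk1.
have j0S : i j0 \in S by apply: imset_f.
have x0 : (x : finvect_type V) != 0.
  by move: j0S; rewrite -xS; apply: contraNneq => ->; rewrite linear0.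
pose v : nzvec V := exist _ (x : finvect_type V) x0.
exists v; split=> //; rewrite -hq -cardS -(card_nzvec_meeting S halpha).
set A := [set w | _].
have vA : v \in A by rewrite inE; apply/existsP; exists (i j0); rewrite j0S xS.
(* The neighbours of [v] are exactly [A :\ v], because adjacency requires distinct vertices;
   removing [v] absorbs the final [- 1]. *)
rewrite (cardsD1 v A) vA addKn; congr #|pred_of_set _|.
apply/setP => w; rewrite !inE /nz_component_adj eq_sym; congr (_ && _).
by apply: eq_existsb => m; rewrite xS.
Qed.
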